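(* Let $G$ be a unicyclic graph with $n \ge 4$ vertices and maximum degree $\Delta \ge 3$, and let $f : [1,\infty) \to \mathbb{R}^+$ be a function such that $\log f$ is concave. Then $$ II_f(G) \le f(\Delta)\, f(2)^{n-\Delta+1} f(1)^{\Delta-2}, $$ and the inequality is attained (i.e., equality holds) if and only if $G \in \mathcal{H}_n^\Delta$.
   Context: All graphs are finite, connected, simple (no loops, no multiple edges) and have at least one edge. A unicyclic graph is a graph containing exactly one cycle. For a vertex $u$ of $G$, $d_u$ denotes its degree. $\mathbb{R}^+$ denotes the positive real numbers. For a function $f:[1,\infty)\to\mathbb{R}^+$, $II_f(G) = \prod_{u\in V(G)} f(d_u)$. For $n\ge 4$ and $3\le \Delta\le n-1$, $\mathcal{H}_n^\Delta$ is the set of graphs (up to isomorphism) obtained from a cycle $C_k$, with $3\le k\le n-\Delta+2$, by attaching to one and the same vertex of the cycle $\Delta-2$ paths of lengths $m_1,\dots,m_{\Delta-2}\ge 1$ (each path having that cycle vertex as an end-vertex, and the paths being otherwise disjoint from each other and from the cycle), where $k+m_1+\dots+m_{\Delta-2}=n$. Equivalently, $\mathcal{H}_n^\Delta$ is the set of unicyclic graphs with $n$ vertices whose degree sequence is $(\Delta,2,\dots,2,1,\dots,1)$ with $n-\Delta+1$ entries equal to $2$ and $\Delta-2$ entries equal to $1$.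
   Formalization: The ''only if'' part of the equality case is stated for log f strictly concave; with log f merely concave it fails (f = 1 gives equality for every G, e.g. the bull graph). The inequality and equality for all G in H_n^Δ are stated for all concave log f. *)

(* Defs.v *)
From HB Require Import structures.
From mathcomp Require Import all_boot all_order all_algebra.
From mathcomp Require Import all_classical all_reals all_analysis.

Set Implicit Arguments.
Unset Strict Implicit.
Unset Printing Implicit Defensive.

Import Order.TTheory GRing.Theory Num.Theory.

Record sgraph := SGraph {
  vertex :> finType;
  adj : rel vertex;
  adj_sym : symmetric adj;
  adj_irrefl : irreflexive adj
}.

Definition deg (G : sgraph) (u : G) : nat := #|[set v | adj u v]|.

Definition max_degree (G : sgraph) : nat := \max_(u : G) deg u.

Definition graph_connected (G : sgraph) : Prop :=
  forall u v : G, connect (@adj G) u v.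

(* A cycle is presented by a cyclic listing of its vertices.  As a subgraph it
   is determined by its set of edges, which does not depend on the starting
   vertex or on the orientation of the listing. *)
Definition is_cycle (G : sgraph) (c : seq G) : bool :=
  (2 < size c) && ucycleb (@adj G) c.

Definition cycle_edges (G : sgraph) (c : seq G) : {set {set G}} :=
  [set [set x; next c x] | x in c].

Definition unicyclic (G : sgraph) : Prop :=
  graph_connected G /\
  exists c : seq G, is_cycle c /\
    forall c' : seq G, is_cycle c' -> cycle_edges c' = cycle_edges c.

Definition graph_iso (G H : sgraph) : Prop :=
  exists h : G -> H,
    bijective h /\ forall u v : G, adj (h u) (h v) = adj u v.

Section CycleWithPaths.

(* [inl i] is the [i]-th vertex of the cycle C_k.  [inr (Tagged _ j)] with tag
   [i] is the vertex at distance [j + 1] from [inl 0] on the [i]-th attached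
   path; that path has [m i] edges, hence [m i] vertices off the cycle. *)
Variables (k r : nat) (m : 'I_r -> nat).

Definition cwp_vertex : finType := ('I_k + {i : 'I_r & 'I_(m i)})%type.

Definition cwp_arc (u v : cwp_vertex) : bool :=
  match u, v with
  | inl i, inl j => (j : nat) == (i.+1 %% k)%N
  | inl i, inr b => ((i : nat) == 0%N) && (tagged b == 0%N :> nat)
  | inr a, inr b => (tag a == tag b) && (tagged b == (tagged a).+1 :> nat)
  | inr _, inl _ => false
  end.

(* [u != v] only matters in the unused case [k = 1], where it removes a loop. *)
Definition cwp_adj : rel cwp_vertex :=
  fun u v => (u != v) && (cwp_arc u v || cwp_arc v u).

Lemma cwp_adj_sym : symmetric cwp_adj.
Proof. by move=> u v; rewrite /cwp_adj eq_sym orbC. Qed.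

Lemma cwp_adj_irrefl : irreflexive cwp_adj.
Proof. by move=> u; rewrite /cwp_adj eqxx. Qed.

Definition cycle_with_paths : sgraph := SGraph cwp_adj_sym cwp_adj_irrefl.

End CycleWithPaths.

Definition in_H (n D : nat) (G : sgraph) : Prop :=
  exists (k : nat) (m : 'I_(D - 2) -> nat),
    [/\ (3 <= k <= n - D + 2)%N,
        forall i, (1 <= m i)%N,
        (k + \sum_(i < D - 2) m i = n)%N
      & graph_iso G (cycle_with_paths k m)].

Local Open Scope ring_scope.

Definition II (R : realType) (f : R -> R) (G : sgraph) : R :=
  \prod_(u : G) f (deg u)%:R.

Definition concave_on (R : realType) (D : set R) (g : R -> R) : Prop :=
  convex_function D (fun x : R^o => - g x : R^o).

Definition strictly_concave_on (R : realType) (D : set R) (g : R -> R) : Prop :=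
  {in D &, forall x y : R, x != y -> forall t : R, 0 < t < 1 ->
     t * g x + (1 - t) * g y < g (t * x + (1 - t) * y)}.

(* Main.v *)
Require Import Defs.
From mathcomp Require Import all_boot all_order all_algebra.
From mathcomp Require Import all_classical all_reals all_analysis.
From mathcomp Require Import zify ring lra.

Set Implicit Arguments.
Unset Strict Implicit.
Unset Printing Implicit Defensive.

Import Order.TTheory GRing.Theory Num.Theory.

(** A connected graph with a unique cycle is the graph of a self-map [par] that
    turns around the cycle and moves every other vertex one step closer to it: an
    edge outside the graph of [par] would close up a second cycle.  Hence
    [deg u = 1 + #|par^-1 u|] and the degrees sum to [2n].

    By concavity, [ln f] lies below its secant through 1 and 2 at every integer
    [d >= 1], with equality for [d <= 2], and only there if [ln f] is strictly
    concave.  Summing over all vertices but one of maximum degree gives the bound,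
    with equality exactly when all these other vertices have degree at most 2.

    In that case [par] is injective except above the vertex [p] of degree [D], so
    [p] lies on the cycle, there are [D - 2] leaves, and iterating [par] from the
    leaves until [p] is reached traces the paths attached to the cycle. *)

(** * Orbits on a cycle and distances in a finite relation *)

Lemma fcycle_iter_inj (T : finType) (f : T -> T) (c : seq T) (x : T) (i j : nat) :
  fcycle f c -> uniq c -> x \in c -> (i < size c)%N -> (j < size c)%N ->
  iter i f x = iter j f x -> i = j.
Proof.
move=> fc Uc cx; rewrite -(order_cycle fc Uc cx) => ltio ltjo eqij.
by rewrite -(findex_iter ltio) eqij findex_iter.
Qed.

Lemma fcycle_mem (T : eqType) (f : T -> T) (c : seq T) (x : T) :
  fcycle f c -> x \in c -> f x \in c.
Proof. by move=> fc cx; rewrite -(nextE fc cx) mem_next. Qed.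

(** Take for [dl] the length of a shortest [e]-path into [A]: the first step of such a path lowers
    it. *)
Lemma distance_to_set (T : finType) (e : rel T) (A : pred T) :
  (forall x, exists2 y, connect e x y & A y) ->
  exists dl : T -> nat,
    forall x, ~~ A x -> exists2 y, e x y & (dl y < dl x)%N.
Proof.
move=> eA.
have len x : exists k, [exists p : k.-tuple T, path e x p && A (last x p)].
  have [y /connectP[p ep ->] Ap] := eA x.
  by exists (size p); apply/existsP; exists (in_tuple p); rewrite ep.
exists (fun x => ex_minn (len x)) => x.
case: ex_minnP => k /existsP[[[|y p] sp]] /=; first by move=> ->.
case/andP=> /andP[exy ep] Ap _ _; exists y => //.
case: ex_minnP => l _ minl; rewrite -(eqP sp) ltnS minl //.
by apply/existsP; exists (in_tuple p); rewrite ep.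
Qed.

(** * Unicyclic graphs as graphs of self-maps *)

Section Parent.

Variables (G : sgraph) (c : seq G) (par : G -> G).

(** The potential [dl] forces every orbit of [par] into [c]; the length of [c] rules out orbits of
    period 2. *)
Definition parent_map :=
  [/\ uniq c && fcycle par c, (2 < size c)%N,
      exists dl : G -> nat, forall v, v \notin c -> (dl (par v) < dl v)%N
    & forall u v : G, adj u v = (par u == v) || (par v == u)].

End Parent.

Lemma unicyclic_parent_map (G : sgraph) :
  unicyclic G -> exists (c : seq G) (par : G -> G), parent_map c par.
Proof.
case=> connG [c [/andP[c_gt2 /andP[cycc Uc]] c_unique]].
have [x0 cx0] : exists x0, x0 \in c.
  by case: (c) c_gt2 => // x0 s _; exists x0; rewrite mem_head.
have [dl dlP] : exists dl : G -> nat,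
    forall x, x \notin c -> exists2 y, adj x y & (dl y < dl x)%N.
  by apply: distance_to_set => x; exists x0.
(* The default [v] is never returned: off [c], [dlP] supplies a neighbour of smaller [dl]. *)
pose up v := if v \in c then next c v
             else odflt v [pick w | adj v w && (dl w < dl v)%N].
have up_adj v : adj v (up v).
  rewrite /up; case: ifPn => [cv|/dlP[y ey dly]]; first exact: next_cycle.
  by case: pickP => [w /andP[] //|/(_ y)]; rewrite ey dly.
have up_dl v : v \notin c -> (dl (up v) < dl v)%N.
  move=> ncv; rewrite /up (negbTE ncv); have [y ey dly] := dlP v ncv.
  by case: pickP => [w /andP[] //|/(_ y)]; rewrite ey dly.
have up_cycle : fcycle up c.
  have := cycle_next Uc; rewrite (eq_in_cycle (P := mem c) (e' := frel up)) //.
    by move=> u v cu cv; rewrite /= /up cu.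
exists c, up; split=> //; first by rewrite Uc.
  by exists dl.
pose F := [rel u v | (up u == v) || (up v == u)].
have F_sym : connect_sym F by apply: sym_connect_sym => u v; rewrite /= orbC.
have F_root u : connect F u x0.
  have [n le_dl] := ubnP (dl u); elim: n u le_dl => // n IHn u le_dl.
  have [cu|/up_dl lt_dl] := boolP (u \in c).
    apply: (connect_sub (e := frel up)).
      by move=> x y /= exy; apply: connect1; rewrite /= exy.
    by rewrite (fconnect_cycle up_cycle cu).
  apply: connect_trans (connect1 _) (IHn (up u) _); first by rewrite /= eqxx.
  by lia.
have F_adj u v : F u v -> adj u v.
  by case/orP=> /eqP <-; rewrite ?up_adj // adj_sym up_adj.
move=> u v; apply/idP/idP; last exact: F_adj.
(* An edge [u v] outside [F] closes a simple [F]-path from [u] to [v] into a cycle. By uniqueness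
   this edge lies on [c], where [up] is [next c], so it belongs to [F] after all. *)
apply: contraTT => /negbTE nFuv; apply/negP => euv.
have /connectP[p0 Fp0 def_v0] : connect F u v.
  by apply: connect_trans (F_root u) _; rewrite F_sym.
move: def_v0; case/shortenP: Fp0 => p Fp Up _ def_v.
have p_gt1 : (1 < size p)%N.
  case: p Fp def_v {Up} => [|y [|z p]] //=.
    by move=> _ uv; move: euv; rewrite uv adj_irrefl.
  by rewrite andbT => Fuy vy; rewrite -vy /= in Fuy; rewrite nFuv in Fuy.
have cycp : is_cycle (u :: p).
  rewrite /is_cycle /ucycleb Up ltnS p_gt1 /= andbT rcons_path -def_v.
  by rewrite (sub_path F_adj Fp) adj_sym.
have : [set v; u] \in cycle_edges (u :: p).
  apply/imsetP; exists v; first by rewrite def_v mem_last.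
  have := cycle_next Up; rewrite /cycle rcons_path -def_v.
  by case/andP=> _ /eqP->.
rewrite (c_unique _ cycp) => /imsetP[z cz e].
have upz : up z = next c z by rewrite /up cz.
rewrite -upz in e.
have : u \in [set v; u] by rewrite !inE eqxx orbT.
have : v \in [set v; u] by rewrite !inE eqxx.
rewrite e !inE => /orP[] /eqP ev /orP[] /eqP eu; move: nFuv euv;
  by rewrite ev eu /= ?adj_irrefl ?eqxx ?orbT.
Qed.

(** * Degrees in terms of preimages *)

Section ParentTheory.

Variables (G : sgraph) (c : seq G) (par : G -> G).
Hypothesis parG : parent_map c par.

Let Uc : uniq c. Proof. by case: parG => /andP[]. Qed.
Let par_cycle : fcycle par c. Proof. by case: parG => /andP[]. Qed.
Let c_gt2 : (2 < size c)%N. Proof. by case: parG. Qed.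
Let adjE (u v : G) : adj u v = (par u == v) || (par v == u).
Proof. by case: parG. Qed.

(** On [c] a return after two steps contradicts the length of [c]; off [c] it would make [dl] drop
    twice and come back. *)
Lemma parent_map_par2 (u : G) : par (par u) != u.
Proof.
have [cu|ncu] := boolP (u \in c).
  have c_gt0 : (0 < size c)%N by lia.
  by apply/eqP => /(fcycle_iter_inj (i := 2) (j := 0) par_cycle Uc cu c_gt2 c_gt0).
case: parG => _ _ [dl dlP] _; apply/eqP => e.
have ncpu : par u \notin c.
  by apply: contra ncu => /(fcycle_mem par_cycle); rewrite e.
by have := dlP _ ncu; have := dlP _ ncpu; rewrite e; lia.
Qed.

Lemma parent_map_deg (u : G) : deg u = #|[set v | par v == u]|.+1.
Proof.
have -> : deg u = #|par u |: [set v | par v == u]|.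
  by apply: eq_card => v; rewrite !inE adjE eq_sym.
by rewrite cardsU1 inE (negbTE (parent_map_par2 u)).
Qed.

Lemma sum_card_preimages : (\sum_(u : G) #|[set v | par v == u]| = #|G|)%N.
Proof.
rewrite -[RHS]sum1_card [RHS](partition_big par xpredT) //=.
by apply: eq_bigr => u _; rewrite -sum1_card; apply: eq_bigl => v; rewrite inE.
Qed.

Lemma parent_map_sum_deg : (\sum_(u : G) deg u = 2 * #|G|)%N.
Proof.
under eq_bigr do rewrite parent_map_deg -addn1.
by rewrite big_split /= sum_card_preimages sum1_card addnn mul2n.
Qed.

(** * Graphs with a single vertex of degree above 2 *)

Section OneBranchVertex.

Variable p : G.
Hypothesis p_deg : (2 < deg p)%N.
Hypothesis deg_le2 : forall u, u != p -> (deg u <= 2)%N.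

Let par_inj (x y : G) : par x = par y -> par x != p -> x = y.
Proof.
move=> e /deg_le2; rewrite parent_map_deg ltnS => /card_le1_eqP; apply.
  by rewrite inE e.
by rewrite inE.
Qed.

(** A vertex of [c] already has a preimage on [c]; a second one from outside is possible only at
    [p]. *)
Let par_entry (z : G) : z \notin c -> par z \in c -> par z = p.
Proof.
move=> ncz cz; apply/eqP; apply: contraNT ncz => nzp.
have cw : prev c (par z) \in c by rewrite mem_prev.
rewrite (par_inj (y := prev c (par z)) _ nzp) //.
by rewrite -(nextE par_cycle cw) next_prev.
Qed.

(** Otherwise the orbit of [p], which starts off [c], enters [c] at some point, and by [par_entry]
    that point is [p]. *)
Let c_p : p \in c.
Proof.
case: parG => _ _ [dl dlP] _; apply/negPn/negP => ncp.
have [n] := ubnP (dl p); elim: n {1 2}p (ncp) => // n IHn v ncv le_dl.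
have [cpv|ncpv] := boolP (par v \in c).
  by move: ncp; rewrite -(par_entry ncv cpv) cpv.
by apply: IHn ncpv _; have := dlP _ ncv; lia.
Qed.

Let reach (v : G) : exists k, iter k par v == p.
Proof.
case: parG => _ _ [dl dlP] _.
have [n] := ubnP (dl v); elim: n v => // n IHn v le_dl.
have [cv|/dlP lt_dl] := boolP (v \in c).
  have : fconnect par v p by rewrite (fconnect_cycle par_cycle cv).
  by move/iter_findex => <-; exists (findex par v p).
have [|k kP] := IHn (par v); first by lia.
by exists k.+1; rewrite iterSr.
Qed.

Let height v := ex_minn (reach v).

Let iter_height v : iter (height v) par v = p.
Proof. by rewrite /height; case: ex_minnP => k /eqP. Qed.

Let off_cycle v k : v \notin c -> (k < height v)%N -> iter k par v \notin c.
Proof.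
move=> ncv; elim: k => // k IHk lt_k.
apply/negP => ck; have e := par_entry (IHk (ltnW lt_k)) ck.
move: lt_k; rewrite /height; case: ex_minnP => l _ /(_ k.+1).
by rewrite /= e eqxx; lia.
Qed.

Let leaves := [set u | #|[set v | par v == u]| == 0%N].

Let leafP u v : u \in leaves -> par v != u.
Proof.
rewrite inE; apply: contraTN => puv; rewrite -lt0n.
by apply/card_gt0P; exists v; rewrite inE.
Qed.

Let leaf_off u : u \in leaves -> u \notin c.
Proof.
move=> /leafP Lu; apply/negP => cu.
have cw : prev c u \in c by rewrite mem_prev.
by have := Lu (prev c u); rewrite -(nextE par_cycle cw) next_prev ?eqxx.
Qed.

(** For each [u != p], the number of preimages plus the leaf indicator is 1. Summing, and removing
    the [deg p - 1] preimages of [p] from the total [#|G|], leaves this count. *)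
Let card_leaves : #|leaves| = (deg p - 2)%N.
Proof.
have e : (\sum_(u | u != p) (#|[set v | par v == u]| + (u \in leaves))
          = #|G|.-1)%N.
  rewrite -(cardC1 p) -sum1_card.
  apply: eq_big => [u|u /deg_le2]; first by rewrite !inE.
  rewrite parent_map_deg ltnS inE.
  by case: #|_| => [|[|]].
move: e; rewrite big_split /= -big_mkcondr /= sum1_card.
have := sum_card_preimages; rewrite (bigD1 p) //=.
have := parent_map_deg p.
have -> : #|[pred u | (u != p) && (u \in leaves)]| = #|leaves|.
  apply: eq_card => u; rewrite !inE; case: eqVneq => //= ->.
  apply/esym/negbTE; rewrite -lt0n.
  by have := p_deg; rewrite parent_map_deg; lia.
by have := p_deg; lia.
Qed.

(** Cancel [par] on both sides, which is allowed before [p] is reached; if one side runs out first,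
    a leaf has a preimage. *)
Let chain_inj u v a b : u \in leaves -> v \in leaves ->
  (a < height u)%N -> (b < height v)%N ->
  iter a par u = iter b par v -> u = v /\ a = b.
Proof.
move=> Lu Lv; elim: a b => [|a IHa] [|b] //= ltau ltbv e.
- by have := leafP (iter b par v) Lu; rewrite e eqxx.
- by have := leafP (iter a par u) Lv; rewrite e eqxx.
have [|-> ->//] := IHa b (ltnW ltau) (ltnW ltbv).
apply: par_inj e _; apply: contraNneq (off_cycle (leaf_off Lu) ltau) => /= ->.
exact: c_p.
Qed.

Let leaf_above v : v \notin c ->
  exists2 u, u \in leaves & exists2 k, (k < height u)%N & v = iter k par u.
Proof.
case: parG => _ _ [dl dlP] _ ncv.
(* Among the vertices whose orbit meets [v], one of largest [dl] is a leaf, since a preimage would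
   have larger [dl]. *)
have [u cuv max_u] := @arg_maxnP _ v (fun u => fconnect par u v) dl (connect0 _ _).
have cK k x : x \in c -> iter k par x \in c.
  by elim: k => //= k IHk /IHk; apply: fcycle_mem.
have ncu w : fconnect par w v -> w \notin c.
  by move=> /iter_findex e; apply: contra ncv => /(cK (findex par w v)); rewrite e.
exists u.
  rewrite inE; apply/eqP; apply: eq_card0 => w; rewrite !inE; apply/negP => /eqP pwu.
  have cwv : fconnect par w v.
    by apply: connect_trans cuv; apply: connect1; rewrite /= pwu.
  by have := max_u w cwv; have := dlP _ (ncu _ cwv); rewrite pwu; lia.
exists (findex par u v); last by rewrite iter_findex.
(* After [height u] steps the orbit is at [p], hence on [c] for ever. *)
rewrite ltnNge; apply: contra ncv => le_h.
by rewrite -(iter_findex cuv) -(subnK le_h) iterD iter_height cK ?c_p.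
Qed.

(** * The isomorphism with a cycle with attached paths *)

Let leaf (i : 'I_(deg p - 2)) : G := enum_val (cast_ord (esym card_leaves) i).

Let leaf_mem i : leaf i \in leaves. Proof. exact: enum_valP. Qed.

Let leaf_inj : injective leaf.
Proof. by move=> i j /enum_val_inj/cast_ord_inj. Qed.

Let m i := height (leaf i).

Let m_gt0 i : (0 < m i)%N.
Proof.
rewrite lt0n; apply: contraNneq (leaf_off (leaf_mem i)) => e.
by rewrite -[leaf i]/(iter 0 par (leaf i)) -e iter_height c_p.
Qed.

(** Path vertices are indexed outwards from [p] but reached inwards from the leaf: index 0 is the
    last vertex before [p], index [(m i).-1] the leaf itself. *)
Let place (x : cycle_with_paths (size c) m) : G :=
  match x with
  | inl i => iter i par p
  | inr b => iter ((m (tag b)).-1 - tagged b) par (leaf (tag b))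
  end.

Let place_inl i : place (inl i) \in c.
Proof.
by rewrite /=; elim: (i : nat) => [|k IHk] /=; [exact: c_p|exact: fcycle_mem].
Qed.

Let place_inr b : place (inr b) \notin c.
Proof.
have lt_b := ltn_ord (tagged b).
by apply: off_cycle (leaf_off (leaf_mem _)) _; rewrite -/(m _); lia.
Qed.

Let place_inj : injective place.
Proof.
move=> [i|b] [i'|b'] e.
- by congr inl; apply/val_inj; apply: fcycle_iter_inj par_cycle Uc c_p _ _ e.
- by have := place_inr b'; rewrite -e place_inl.
- by have := place_inr b; rewrite e place_inl.
case: b b' e => i j [i' j'] e.
have lt_j := ltn_ord j; have lt_j' := ltn_ord j'.
have [||/leaf_inj ei ej] := chain_inj (leaf_mem i) (leaf_mem i') _ _ e.
- by rewrite /= -/(m _); lia.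
- by rewrite /= -/(m _); lia.
by subst i'; rewrite (_ : j = j') //; apply/val_inj; move: ej => /=; lia.
Qed.

Let place_surj v : exists x, place x = v.
Proof.
have [cv|/leaf_above[u Lu [k ltk ->]]] := boolP (v \in c).
  have pv : fconnect par p v by rewrite (fconnect_cycle par_cycle c_p).
  have lt_v : (findex par p v < size c)%N.
    by rewrite -(order_cycle par_cycle Uc c_p) findex_max.
  by exists (inl (Ordinal lt_v)); rewrite /= iter_findex.
pose i := cast_ord card_leaves (enum_rank_in Lu u).
have ei : leaf i = u by rewrite /leaf /i cast_ordK enum_rankK_in.
have lt_j : ((height u).-1 - k < m i)%N by rewrite /m ei; lia.
exists (inr (Tagged (fun i => 'I_(m i)) (Ordinal lt_j))) => /=.
by rewrite /m ei; congr iter; lia.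
Qed.

Let par_place_inr b : par (place (inr b)) =
  iter (m (tag b) - tagged b) par (leaf (tag b)).
Proof.
suff -> : (m (tag b) - tagged b = ((m (tag b)).-1 - tagged b).+1)%N by [].
by have := ltn_ord (tagged b); lia.
Qed.

Let arc_cycle i j : (par (place (inl i)) == place (inl j)) =
  (j == i.+1 %% size c :> nat)%N.
Proof.
have pc : iter (size c) par p = p.
  have := iter_order_cycle par_cycle c_p c_p.
  by rewrite (order_cycle par_cycle Uc c_p).
have c_gt0 : (0 < size c)%N by lia.
have -> : par (place (inl i)) = iter (i.+1 %% size c) par p.
  have := ltn_ord i; rewrite leq_eqVlt => /orP[/eqP e|lti].
    by rewrite e modnn /= -iterS e pc.
  by rewrite modn_small.
apply/eqP/eqP => [/= e|/= -> //]; symmetry.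
by apply: (fcycle_iter_inj par_cycle Uc c_p) e; rewrite ?ltn_pmod.
Qed.

(** On the paths [cwp_arc] points away from the cycle, against [par], whereas on the cycle the two
    agree; hence the exchanged arguments here and in [arc_path]. *)
Let arc_entry i b : (par (place (inr b)) == place (inl i)) =
  ((i : nat) == 0)%N && (tagged b == 0 :> nat)%N.
Proof.
have mb := ltn_ord (tagged b); have c_gt0 : (0 < size c)%N by lia.
have [b0|bn0] := eqVneq (tagged b : nat) 0%N; last first.
  rewrite andbF; apply/eqP => e; have := place_inl i; rewrite -e par_place_inr.
  by apply/negP; apply: off_cycle (leaf_off (leaf_mem _)) _; rewrite -/(m _); lia.
rewrite andbT par_place_inr b0 subn0 iter_height.
apply/eqP/eqP => [/= e|/= -> //]; symmetry.
by apply: (fcycle_iter_inj (i := 0) par_cycle Uc c_p) e.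
Qed.

Let arc_path a b : (par (place (inr b)) == place (inr a)) =
  (tag a == tag b) && (tagged b == (tagged a).+1 :> nat)%N.
Proof.
case: a b => i j [i' j']; have lt_j := ltn_ord j; have lt_j' := ltn_ord j'.
rewrite par_place_inr /=; have [j0|jn0] := eqVneq (j' : nat) 0%N.
  rewrite j0 andbF subn0 iter_height.
  apply: contraNF (place_inr (Tagged (fun i => 'I_(m i)) j)) => /= /eqP <-.
  exact: c_p.
apply/eqP/andP => [e|[/eqP ei /eqP ej]]; last first.
  by subst i'; congr iter; lia.
have [||/leaf_inj ei ej] := chain_inj (leaf_mem i') (leaf_mem i) _ _ e.
- by rewrite -/(m _); lia.
- by rewrite -/(m _); lia.
by subst i'; rewrite eqxx; split=> //; apply/eqP; lia.
Qed.

Let arc_place x y :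
  (par (place x) == place y) || (par (place y) == place x) =
  cwp_arc x y || cwp_arc y x.
Proof.
have off i b : (par (place (inl i)) == place (inr b)) = false.
  by apply: contraNF (place_inr b) => /eqP <-; exact: fcycle_mem (place_inl i).
case: x y => [i|a] [j|b].
- by rewrite !arc_cycle.
- by rewrite off arc_entry orbF.
- by rewrite off arc_entry orbF.
- by rewrite !arc_path orbC.
Qed.

Let place_adj x y : adj (place x) (place y) = adj x y.
Proof.
have [->|nxy] := eqVneq x y; first by rewrite !adj_irrefl.
by rewrite adjE arc_place /= /cwp_adj nxy.
Qed.

Lemma parent_map_in_H : in_H #|G| (deg p) G.
Proof.
pose h v := projT1 (cid (place_surj v)).
have hK : cancel h place by move=> v; rewrite /h; case: cid.
have placeK : cancel place h by move=> x; apply: place_inj; rewrite hK.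
have card_G : (size c + \sum_(i < deg p - 2) m i = #|G|)%N.
  by rewrite -(bij_eq_card (Bijective placeK hK)) card_sum card_ord tagnat.card.
(* Together with [card_G] this yields the upper bound on the cycle length. *)
have sum_m : (deg p - 2 <= \sum_(i < deg p - 2) m i)%N.
  rewrite -{1}[(deg p - 2)%N]card_ord -sum1_card; apply: leq_sum => i _.
  exact: m_gt0.
exists (size c), m; split=> //; first by move: c_gt2 p_deg; lia.
exists h; split; first exact: Bijective hK placeK.
by move=> u v; rewrite -place_adj !hK.
Qed.

End OneBranchVertex.

End ParentTheory.

(** * Degrees in a cycle with attached paths *)

Lemma cwp_arc_unique_source (k r : nat) (m : 'I_r -> nat)
  (x x' y : cwp_vertex k m) :
  cwp_arc x y -> cwp_arc x' y -> x = x'.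
Proof.
case: y => [j|[t b]]; case: x => [i|[s a]]; case: x' => [i'|[s' a']] //=.
- move=> /eqP e /eqP; rewrite e => /eqP; rewrite -[i.+1]add1n -[i'.+1]add1n.
  rewrite eqn_modDl !modn_small // => /eqP ii'; congr inl; exact/val_inj.
- move=> /andP[/eqP i0 _] /andP[/eqP i0' _].
  by congr inl; apply/val_inj; rewrite /= i0.
- by move=> /andP[_ /eqP b0] /andP[_ /eqP]; rewrite b0.
- by move=> /andP[_ /eqP b0] /andP[_ /eqP]; rewrite b0.
move=> /andP[/eqP st /eqP ba] /andP[/eqP st' /eqP ba']; subst s s'.
have -> // : a = a'; by apply/val_inj; rewrite /=; lia.
Qed.

Lemma cwp_arc_unique_target (k r : nat) (m : 'I_r -> nat)
  (x y y' : cwp_vertex k m) :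
  (forall i, x = inl i -> (0 < i)%N) -> cwp_arc x y -> cwp_arc x y' -> y = y'.
Proof.
case: x => [i /(_ i erefl) i_gt0|[s a] _].
  case: y => [j|b]; case: y' => [j'|b'] /=; rewrite ?(gtn_eqF i_gt0) //.
  by move=> /eqP e /eqP e'; congr inl; apply/val_inj; rewrite /= e e'.
case: y => [//|[t b]]; case: y' => [//|[t' b']] /=.
move=> /andP[/eqP st /eqP ba] /andP[/eqP st' /eqP ba']; subst t t'.
have -> // : b = b'; by apply/val_inj; rewrite /=; lia.
Qed.

(** At most one arc enters and at most one leaves; the hypothesis excludes the branch vertex
    [inl 0]. *)
Lemma cycle_with_paths_deg (k r : nat) (m : 'I_r -> nat)
  (x : cycle_with_paths k m) :
  (forall i, x = inl i -> (0 < i)%N) -> (deg x <= 2)%N.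
Proof.
move=> nx; rewrite /deg.
have sub : [set y | adj x y] \subset
    [set y | cwp_arc x y] :|: [set y | cwp_arc y x].
  by apply/fintype.subsetP => y; rewrite !inE => /andP[].
apply: leq_trans (subset_leq_card sub) (leq_trans (leq_card_setU _ _) _).
rewrite -[2%N]/(1 + 1)%N; apply: leq_add; apply/card_le1_eqP => y y'; rewrite !inE.
  by move=> xy xy'; apply: cwp_arc_unique_target xy' xy.
by move=> yx y'x; apply: cwp_arc_unique_source y'x yx.
Qed.

Lemma graph_iso_deg_le (G H : sgraph) (h : G -> H) (u : G) :
  injective h -> (forall v w : G, adj (h v) (h w) = adj v w) ->
  (deg u <= deg (h u))%N.
Proof.
move=> h_inj h_adj; rewrite /deg -(card_imset _ h_inj); apply: subset_leq_card.
by apply/fintype.subsetP => _ /imsetP[v + ->]; rewrite !inE h_adj.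
Qed.

Lemma in_H_deg (n D : nat) (G : sgraph) :
  in_H n D G -> exists p : G, forall u, u != p -> (deg u <= 2)%N.
Proof.
case=> k [m [/andP[k_ge3 _] _ _ [h [[g hK gK] h_adj]]]].
have k_gt0 : (0 < k)%N by lia.
exists (g (inl (Ordinal k_gt0))) => u nu.
apply: leq_trans (graph_iso_deg_le u (can_inj hK) h_adj) (cycle_with_paths_deg _).
move=> i hu; rewrite lt0n; apply: contraNneq nu => i0.
by rewrite -[u]hK hu; apply/eqP; congr (g (inl _)); apply/val_inj.
Qed.

Local Open Scope ring_scope.

(** * Concave functions and their secant through 1 and 2 *)

Section Secant.

Variables (R : realType) (g : R -> R).

Definition secant12 (x : R) : R := g 2 + (x - 2) * (g 2 - g 1).

(** The weight [t] writes 2 as a convex combination of 1 and [d]. *)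
Let conv_coef (d : nat) : (2 < d)%N ->
  let t : R := (d%:R - 2) / (d%:R - 1) in
  0 < t < 1 /\ t * 1 + (1 - t) * d%:R = 2.
Proof.
move=> d_gt2 t; have d_ge3 : 3 <= d%:R :> R by rewrite (ler_nat R 3).
have d1 : d%:R - 1 != 0 :> R by apply/eqP; lra.
split; last by rewrite /t; field.
by rewrite /t ltr_pdivrMr ?divr_gt0; lra.
Qed.

Let in_dom (d : nat) : (0 < d)%N -> (d%:R : R) \in `[1, +oo[%classic.
Proof. by move=> d_gt0; rewrite inE /= in_itv /= andbT ler1n. Qed.

(** The gap below the secant at [d] is the concavity gap at 2 scaled by [d - 1 > 0], so weak and
    strict inequalities both transfer. *)
Let secant_step (d : nat) (t : R) : (2 < d)%N ->
  t = (d%:R - 2) / (d%:R - 1) ->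
  secant12 d%:R - g d%:R = (g 2 - (t * g 1 + (1 - t) * g d%:R)) * (d%:R - 1).
Proof.
move=> d_gt2 ->; have d_ge3 : 3 <= d%:R :> R by rewrite (ler_nat R 3).
have d1 : d%:R - 1 != 0 :> R by apply/eqP; lra.
by rewrite /secant12; field.
Qed.

Lemma secant12_eq (d : nat) : (0 < d <= 2)%N -> g d%:R = secant12 d%:R.
Proof. by case: d => [|[|[|]]] // _; rewrite /secant12; ring. Qed.

Lemma concave_le_secant12 (d : nat) : concave_on `[1, +oo[%classic g ->
  (0 < d)%N -> g d%:R <= secant12 d%:R.
Proof.
move=> g_conc d_gt0; have [d_le2|d_gt2] := leqP d 2.
  by rewrite -secant12_eq ?d_gt0.
have [/andP[t_gt0 t_lt1] t2] := conv_coef d_gt2.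
set t := (_ / _) in t_gt0 t_lt1 t2.
have le2 : - g 2 <= t * - g 1 + (1 - t) * - g d%:R.
  rewrite -{1}t2.
  exact: (g_conc (Itv01 (ltW t_gt0) (ltW t_lt1))
            1 d%:R (in_dom (isT : 0 < 1)%N) (in_dom d_gt0)).
rewrite -subr_ge0 (secant_step d_gt2 (erefl t)) mulr_ge0 //.
  by lra.
by rewrite subr_ge0 ler1n.
Qed.

Lemma strictly_concave_lt_secant12 (d : nat) :
  strictly_concave_on `[1, +oo[%classic g ->
  (2 < d)%N -> g d%:R < secant12 d%:R.
Proof.
move=> g_conc d_gt2; have d_gt0 : (0 < d)%N by lia.
have [t01 t2] := conv_coef d_gt2; set t := (_ / _) in t01 t2.
have n1d : 1 != d%:R :> R by rewrite (eqr_nat R 1); lia.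
have := g_conc _ _ (in_dom (isT : 0 < 1)%N) (in_dom d_gt0) n1d _ t01.
rewrite t2 => lt2; rewrite -subr_gt0 (secant_step d_gt2 (erefl t)).
by rewrite mulr_gt0 ?subr_gt0 // ltr1n; lia.
Qed.

End Secant.

(** * Both sides of the inequality as exponentials *)

Section Bound.

Variables (R : realType) (G : sgraph) (f : R -> R) (p : G).
Hypothesis G_uni : unicyclic G.
Hypothesis f_pos : forall x : R, 1 <= x -> 0 < f x.
Hypothesis p_deg : (2 < deg p)%N.

Let g (x : R) := ln (f x).

Lemma unicyclic_deg_gt0 (u : G) : (0 < deg u)%N.
Proof.
by have [c [par parG]] := unicyclic_parent_map G_uni; rewrite (parent_map_deg parG).
Qed.

Lemma II_expR : II f G = expR (g (deg p)%:R + \sum_(u | u != p) g (deg u)%:R).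
Proof.
have -> : g (deg p)%:R + \sum_(u | u != p) g (deg u)%:R = \sum_(u : G) g (deg u)%:R.
  by rewrite [RHS](bigD1 p).
rewrite expR_sum; apply: eq_bigr => u _; rewrite lnK // posrE f_pos // ler1n.
exact: unicyclic_deg_gt0.
Qed.

(** The secant is affine, so its sum over the vertices other than [p] depends only on their number
    [#|G| - 1] and their degree sum [2 * #|G| - deg p]. *)
Lemma bound_expR :
  f (deg p)%:R * f 2 ^+ (#|G| - deg p + 1) * f 1 ^+ (deg p - 2) =
  expR (g (deg p)%:R + \sum_(u | u != p) secant12 g (deg u)%:R).
Proof.
have expg (d : nat) : (0 < d)%N -> expR (g d%:R) = f d%:R.
  by move=> d_gt0; rewrite lnK // posrE f_pos // ler1n.
have le_deg : (deg p <= #|G|)%N by apply: max_card.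
have sum_deg : \sum_(u | u != p) (deg u)%:R = 2 * #|G|%:R - (deg p)%:R :> R.
  have [c [par parG]] := unicyclic_parent_map G_uni.
  rewrite -natrM -(parent_map_sum_deg parG) natr_sum.
  rewrite [X in _ = X - _](bigD1 p) //=.
  by rewrite [RHS]addrC addKr.
have card_others : \sum_(u | u != p) 1 = #|G|%:R - 1 :> R.
  rewrite sumr_const cardC1 -subn1 natrB //.
  by apply/card_gt0P; exists p.
have -> : \sum_(u | u != p) secant12 g (deg u)%:R =
    (#|G| - deg p + 1)%:R * g 2 + (deg p - 2)%:R * g 1.
  under eq_bigr => u _.
    rewrite (_ : secant12 _ _ =
      (deg u)%:R * (g 2 - g 1) + 1 * (2 * g 1 - g 2)); last first.
      by rewrite /secant12; ring.
    over.
  rewrite big_split /= -!mulr_suml sum_deg card_others natrD !natrB //; last by lia.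
  by ring.
by rewrite !expRD !expRM_natl (expg 1%N) // (expg 2%N) // expg ?mulrA //; lia.
Qed.

End Bound.

(** Strict concavity is what makes equality force membership in [in_H]: if [ln f] is affine, the
    degree sum alone fixes [II f G], and every such [G] attains the bound. *)
Theorem theorem4p9 (R : realType) (G : sgraph) (n D : nat) (f : R -> R)
  (Guni : unicyclic G) (Gn : #|G| = n) (n_ge4 : (4 <= n)%N)
  (GD : max_degree G = D) (D_ge3 : (3 <= D)%N)
  (f_pos : forall x : R, 1 <= x -> 0 < f x)
  (lnf_concave : concave_on `[1, +oo[%classic (fun x => ln (f x))) :
  [/\ II f G <= f D%:R * f 2 ^+ (n - D + 1) * f 1 ^+ (D - 2),
      in_H n D G -> II f G = f D%:R * f 2 ^+ (n - D + 1) * f 1 ^+ (D - 2)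
    & strictly_concave_on `[1, +oo[%classic (fun x => ln (f x)) ->
      (II f G = f D%:R * f 2 ^+ (n - D + 1) * f 1 ^+ (D - 2) <-> in_H n D G)].
Proof.
have [|p def_D] := @bigop.eq_bigmax G (@deg G); first by lia.
rewrite -/(max_degree G) GD in def_D; subst D n; rewrite def_D in D_ge3 *.
rewrite (bound_expR Guni f_pos D_ge3) (II_expR p Guni f_pos).
set g := fun x => ln (f x).
have le_secant (u : G) : g (deg u)%:R <= secant12 g (deg u)%:R.
  exact: (concave_le_secant12 lnf_concave (unicyclic_deg_gt0 Guni u)).
have eq_of_H : in_H #|G| (deg p) G ->
    \sum_(u | u != p) g (deg u)%:R = \sum_(u | u != p) secant12 g (deg u)%:R.
  case/in_H_deg=> q deg_le2.
  (* The exceptional vertex [q] must be [p], whose degree exceeds 2. *)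
  have pq : p = q by apply/eqP; apply: contraTT D_ge3 => /deg_le2; rewrite -leqNgt.
  apply: eq_bigr => u; rewrite pq => /deg_le2 du.
  by rewrite -secant12_eq // unicyclic_deg_gt0.
split=> [|/eq_of_H -> //|g_strict].
  by rewrite ler_expR lerD2l; apply: ler_sum => u _; exact: le_secant.
split=> [/expR_inj/addrI e|/eq_of_H -> //].
have [c [par parG]] := unicyclic_parent_map Guni.
apply: (parent_map_in_H parG D_ge3) => u nup.
rewrite leqNgt; apply/negP => du.
(* Nonnegative gaps with zero sum all vanish, but the gap at a vertex of degree above 2 is
   positive. *)
have /psumr_eq0P H0 : \sum_(u | u != p) (secant12 g (deg u)%:R - g (deg u)%:R) = 0.
  by rewrite sumrB e subrr.
have := strictly_concave_lt_secant12 g_strict du.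
by rewrite -subr_gt0 H0 ?ltxx // => v _; rewrite subr_ge0.
Qed.
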